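(* Let $G$ be a finitely generated subgroup of Thompson's group $V$. Then either $G$ is virtually abelian, or $G$ contains a non-abelian free semigroup.
   Context: Thompson's group $V$: let $\mathfrak C=\{0,1\}^{\infty}$ be the Cantor set, and for $a\in\{0,1\}^*$ let $[a]=\{a\eta:\eta\in\{0,1\}^\infty\}$. $V$ is the group of all homeomorphisms of $\mathfrak C$ of the form $a_j\eta\mapsto b_j\eta$ ($\eta\in\{0,1\}^\infty$, $j=1,\dots,m$), where $\mathfrak C=[a_1]\sqcup\dots\sqcup[a_m]=[b_1]\sqcup\dots\sqcup[b_m]$. A group contains a non-abelian free semigroup if it contains two elements generating a free semigroup of rank $2$. *)

(* Defs.v *)
From HB Require Import structures.
From mathcomp Require Import all_boot.
From mathcomp Require Import boolp classical_sets functions cardinality.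
From mathcomp Require Import topology cantor.

Set Implicit Arguments.
Unset Strict Implicit.
Unset Printing Implicit Defensive.

Local Open Scope classical_set_scope.
Local Open Scope group_scope.

Section Groups.
Variable gT : groupType.
Implicit Types (G H S : set gT).

Definition subgroup H : Prop :=
  [/\ H 1,
      forall x y, H x -> H y -> H (x * y) &
      forall x, H x -> H x^-1].

Definition finitely_generated G : Prop :=
  exists2 S, finite_set S & G = smallest subgroup S.

Definition left_cosets G H : set (set gT) :=
  [set [set x * h | h in H] | x in G].

Definition virtually_abelian G : Prop :=
  exists H, [/\ subgroup H, H `<=` G,
    forall x y, H x -> H y -> commute x y &
    finite_set (left_cosets G H)].

(* The elements of the free semigroup on two letters are the nonempty words
   over [bool]; the condition says that the evaluation morphism sending the
   letters to [x] and [y] is injective. *)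
Definition generates_free_semigroup (x y : gT) : Prop :=
  forall u v : seq bool, u != [::] -> v != [::] ->
    \prod_(c <- u) (if c then x else y) = \prod_(c <- v) (if c then x else y) ->
    u = v.

Definition contains_free_semigroup G : Prop :=
  exists x y, [/\ G x, G y & generates_free_semigroup x y].

End Groups.

Section Homeomorphisms.
Variable T : topologicalType.

Record homeo : Type := Homeo {
  homeo_fun :> T -> T;
  homeo_inv : T -> T;
  homeo_funK : cancel homeo_fun homeo_inv;
  homeo_invK : cancel homeo_inv homeo_fun;
  homeo_cts : continuous homeo_fun;
  homeo_inv_cts : continuous homeo_inv }.

HB.instance Definition _ := gen_eqMixin homeo.
HB.instance Definition _ := gen_choiceMixin homeo.

Lemma homeoP (f g : homeo) : f =1 g -> f = g.
Proof.
case: f g => [f f' fK f'K cf cf'] [g g' gK g'K cg cg'] /= /funext fg.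
subst g; have e : f' = g'.
  by apply/funext => x; rewrite -[LHS]gK f'K.
by subst g'; congr Homeo; apply: Prop_irrelevance.
Qed.

Definition homeo_one : homeo :=
  @Homeo idfun idfun (fun=> erefl) (fun=> erefl)
    (fun x => cvg_id) (fun x => cvg_id).

Lemma homeo_comp_cts (f g : T -> T) :
  continuous f -> continuous g -> continuous (f \o g).
Proof. by move=> cf cg x; apply: continuous_comp; [exact: cg|exact: cf]. Qed.

Definition homeo_mul (f g : homeo) : homeo :=
  @Homeo (f \o g) (homeo_inv g \o homeo_inv f)
    (can_comp (homeo_funK f) (homeo_funK g))
    (can_comp (homeo_invK g) (homeo_invK f))
    (homeo_comp_cts (@homeo_cts f) (@homeo_cts g))
    (homeo_comp_cts (@homeo_inv_cts g) (@homeo_inv_cts f)).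

Definition homeo_inverse (f : homeo) : homeo :=
  Homeo (homeo_invK f) (homeo_funK f) (@homeo_inv_cts f) (@homeo_cts f).

Lemma homeo_mulA : associative homeo_mul.
Proof. by move=> f g h; apply: homeoP. Qed.

Lemma homeo_mul1 : left_id homeo_one homeo_mul.
Proof. by move=> f; apply: homeoP. Qed.

Lemma homeo_mulr1 : right_id homeo_one homeo_mul.
Proof. by move=> f; apply: homeoP. Qed.

Lemma homeo_mulV : left_inverse homeo_one homeo_inverse homeo_mul.
Proof. by move=> f; apply: homeoP => x; apply: homeo_funK. Qed.

Lemma homeo_mulrV : right_inverse homeo_one homeo_inverse homeo_mul.
Proof. by move=> f; apply: homeoP => x; apply: homeo_invK. Qed.

HB.instance Definition _ := isGroup.Build homeo
  homeo_mulA homeo_mul1 homeo_mulr1 homeo_mulV homeo_mulrV.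

End Homeomorphisms.

(* The concatenation of a finite word with an infinite one. *)
Definition prepend (a : seq bool) (eta : cantor_space) : cantor_space :=
  fun n => nth (eta (n - size a)%N) a n.

Definition cone (a : seq bool) : set cantor_space := range (prepend a).

Definition cone_partition (m : nat) (a : 'I_m -> seq bool) : Prop :=
  trivIset setT (fun j => cone (a j)) /\ \bigcup_j cone (a j) = setT.

Definition thompsonV : set (homeo cantor_space) :=
  [set f | exists (m : nat) (a b : 'I_m -> seq bool),
    [/\ cone_partition a, cone_partition b &
        forall j eta, f (prepend (a j) eta) = prepend (b j) eta]].

Lemma prepend_cat (a b : seq bool) (eta : cantor_space) :
  prepend (a ++ b) eta = prepend a (prepend b eta).
Proof.
apply/funext => n; rewrite /prepend nth_cat size_cat subnDA.
case: ltnP => h; first exact: set_nth_default.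
by rewrite [RHS]nth_default.
Qed.

Lemma prepend_inj (a : seq bool) : injective (prepend a).
Proof.
move=> x y /(congr1 (fun z : cantor_space => z \o addn (size a))) e.
apply/funext => n; have /= := congr1 (fun z : nat -> bool => z n) e.
by rewrite /prepend !nth_default ?leq_addr // addKn.
Qed.

Lemma prepend_prefix (a w : seq bool) (x y : cantor_space) :
  prepend w x = prepend a y -> (size a <= size w)%N -> exists c, w = a ++ c.
Proof.
move=> e le_aw; exists (drop (size a) w).
rewrite -{1}(cat_take_drop (size a) w); congr cat.
apply: (@eq_from_nth _ true) => [|i]; rewrite size_takel // => ia.
have := congr1 (fun z : nat -> bool => z i) e; rewrite /prepend nth_take //.
by rewrite (set_nth_default true) ?(leq_trans ia) // => ->; exact: set_nth_default.
Qed.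

Lemma prepend_mkseq (N : nat) (x : cantor_space) :
  x = prepend (mkseq x N) (x \o addn N).
Proof.
apply/funext => n; rewrite /prepend size_mkseq /=.
case: (ltnP n N) => h; first by rewrite nth_mkseq.
by rewrite nth_default ?size_mkseq // subnKC.
Qed.

Lemma thompsonVP (f : homeo cantor_space) :
  thompsonV f <-> exists N : nat, forall w : seq bool, (N <= size w)%N ->
    exists b, forall eta, f (prepend w eta) = prepend b eta.
Proof.
split=> [[m [a [b [[_ aT] _ fab]]]]|[N fN]].
  exists (\max_(j < m) size (a j)) => w wN.
  have : [set: cantor_space] (prepend w (fun=> true)) by [].
  rewrite -aT => -[j _ [y _ e]].
  have [c ->] := prepend_prefix (esym e) (leq_trans (leq_bigmax j) wN).
  by exists (b j ++ c) => eta; rewrite !prepend_cat fab.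
pose a (j : 'I_#|{: N.-tuple bool}|) : seq bool := enum_val j.
have size_a j : size (a j) = N by rewrite size_tuple.
have /choice[b fb] j : exists b, forall eta, f (prepend (a j) eta) = prepend b eta.
  by apply: fN; rewrite size_a.
have bE j : cone (b j) = f @` cone (a j).
  apply/seteqP; split=> [_ [y _ <-]|_ [_ [y _ <-] <-]].
    by exists (prepend (a j) y) => //; exists y.
  by exists y; rewrite ?fb.
have a_disj : trivIset setT (fun j => cone (a j)).
  move=> i j _ _ [_ [[x _ <-] [y _ e]]]; apply: enum_val_inj; apply: val_inj.
  apply: (@eq_from_nth _ true) => [|n]; rewrite !size_tuple // => nN.
  have := congr1 (fun z : nat -> bool => z n) e; rewrite /prepend.
  rewrite (set_nth_default true) ?size_a // [RHS](set_nth_default true) ?size_a //.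
have a_cover : \bigcup_j cone (a j) = setT.
  rewrite -subTset => x _.
  exists (enum_rank (Tuple (introT eqP (size_mkseq x N)))) => //.
  by exists (x \o addn N); rewrite // /a enum_rankK /= -prepend_mkseq.
exists #|{: N.-tuple bool}|, a, b; split => //; split.
  move=> i j _ _; rewrite !bE => -[_ [[x ax <-] [y ay e]]].
  apply: a_disj => //; exists x; split=> //.
  by rewrite -(can_inj (homeo_funK f) e).
rewrite -subTset => x _.
have : [set: cantor_space] (homeo_inv f x) by [].
rewrite -a_cover => -[j _ aj]; exists j => //; rewrite bE.
by exists (homeo_inv f x) => //; apply: homeo_invK.
Qed.

Lemma thompsonV_subgroup : subgroup thompsonV.
Proof.
split.
- by apply/thompsonVP; exists 0%N => w _; exists w.
- move=> f g /thompsonVP[N fN] /thompsonVP[M gM]; apply/thompsonVP.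
  exists (M + N)%N => w wMN.
  have [b gb] := gM (take M w) (eq_leq (esym (size_takel (leq_trans (leq_addr N M) wMN)))).
  have [|c fc] := fN (b ++ drop M w).
    by rewrite size_cat size_drop (leq_trans _ (leq_addl _ _)) // leq_subRL // (leq_trans _ wMN) // leq_addr.
  exists c => eta; rewrite -fc -[w in LHS](cat_take_drop M) !prepend_cat.
  by rewrite [LHS](congr1 f (gb _)).
- move=> f [m [a [b [pa pb fab]]]]; exists m, b, a; split=> // j eta.
  by rewrite -fab; apply: homeo_funK.
Qed.

(* Main.v *)
Require Import Defs.
From mathcomp Require Import all_boot zify.
From mathcomp Require Import boolp classical_sets functions cardinality.
From mathcomp Require Import topology cantor.

Set Implicit Arguments.
Unset Strict Implicit.
Unset Printing Implicit Defensive.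

Local Open Scope classical_set_scope.
Local Open Scope group_scope.

(** Elements of [thompsonV] act near each point by replacing a finite prefix of
    the point by another finite word: [carries f w b] says that [f] sends
    [w eta] to [b eta] for every [eta].  If [carries q r (r ++ s)] with [s]
    nonempty, then [q] contracts the cone of [r] towards its fixed point
    [attractor r s], which is [r s s s ...].  Assume that [G] is finitely
    generated in [thompsonV] and contains no free semigroup.

    Such contractions are rigid, for two reasons.  The point
    [x := attractor r s] is the only point of its orbit in the cone of [r]: an
    [h] in [G] that moves [x] elsewhere in that cone gives two maps of the cone
    into disjoint parts of itself, a ping-pong pair ([attractor_isolated]).
    And an element of [G] with trivial germ at [x] is trivial on the whole cone
    of [r] ([trivial_germ_spreads]); otherwise the argument that finds a free
    semigroup in a lamplighter group applies to it and [q] ([lamplighter_free]).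
    Germs at [x] of elements fixing [x] commute, since each of them only shifts
    the length of the prefix of [x] that it replaces ([germs_commute]).
    So if the orbit of [x] is finite, its stabilizer is a subgroup of finite
    index in [G] whose elements commute on the cone of [r]
    ([abelian_on_attractor]).

    Finite generation produces contractions.  Following the letters of a long
    product, the current prefix is a stack of which each letter only reads and
    rewrites the top.  If the stack grows enough, some word recurs on top of it
    at a higher level while nothing below its first occurrence is read in
    between, and the partial product between these two moments is a contraction
    ([rise_bound]).  Falls are rises of the reversed path.  Hence either the
    orbit of [y] enters the cone of a contraction, or prefixes keep bounded
    length and [G] acts on some cone around [y] through finitely many maps
    ([contracted_or_rigid]).

    It follows that every point [y] has a neighbourhood on which some subgroup
    of finite index acts through commuting maps ([abelian_near]).  This
    property transfers to [y] from any point [z] in the closure of its orbit,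
    so one may replace [y] by a [z] whose orbit visits as few cones of depth
    [K] as possible.  If the orbit of [z] enters a contracted cone [r], then
    its attractor [x] lies in the closure of that orbit, and by minimality all
    points in the closure of the orbit of [x] have orbits entering the cone of
    [r].  As [x] is isolated in its orbit, compactness makes the orbit of [x]
    finite, and the previous argument applies.

    Finally, by compactness finitely many of these neighbourhoods cover the
    Cantor set, and the intersection of the corresponding subgroups is an
    abelian subgroup of finite index. *)

Notation homeoC := (homeo cantor_space).

(** * Words and cones *)
Section Words.
Implicit Types (a b c r s w : seq bool) (z eta : cantor_space).

Lemma prepend_word_inj a b : prepend a = prepend b -> a = b.
Proof.
wlog le_ab : a b / (size a <= size b)%N => [hw e|e].
  by case/orP: (leq_total (size a) (size b)) => ?; [|symmetry]; apply: hw.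
have e0 : prepend b (fun=> true) = prepend a (fun=> true) by rewrite e.
have [c bE] := prepend_prefix e0 le_ab.
case: c bE => [|x c] bE; first by rewrite bE cats0.
have := congr1 (fun F : cantor_space -> cantor_space => F (fun=> ~~ x)) e.
rewrite bE /= prepend_cat => /prepend_inj.
by move/(congr1 (fun z : nat -> bool => z 0%N)); rewrite /prepend /=; case: x {bE}.
Qed.

Lemma cone_mkseq z n : cone (mkseq z n) z.
Proof. by exists (z \o addn n) => //; rewrite -prepend_mkseq. Qed.

Lemma cone_catl a b z : cone (a ++ b) z -> cone a z.
Proof. by case=> eta _ <-; rewrite prepend_cat; exists (prepend b eta). Qed.

Lemma cone_prefix a b z :
  cone a z -> cone b z -> (size a <= size b)%N -> exists c, b = a ++ c.
Proof. by move=> [x _ xz] [y _ yz]; apply: (@prepend_prefix _ _ y x); rewrite xz. Qed.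

Lemma cone_word_mkseq w z : cone w z -> w = mkseq z (size w).
Proof.
move=> wz; have [|c] := cone_prefix wz (cone_mkseq z (size w)).
  by rewrite size_mkseq.
move=> e; have := congr1 size e; rewrite size_mkseq size_cat => /eqP.
by case: c e => [|x c] ->; [rewrite cats0|rewrite /=; lia].
Qed.

Lemma mkseq_cat z m n : mkseq z (m + n) = mkseq z m ++ mkseq (z \o addn m) n.
Proof.
rewrite {1}/mkseq iotaD map_cat add0n; congr cat.
by rewrite -[m in iota m n]addn0 iotaDl -map_comp.
Qed.

Lemma cone_mkseq_le z m n : (m <= n)%N -> cone (mkseq z n) `<=` cone (mkseq z m).
Proof. by move=> /subnKC <- y; rewrite mkseq_cat; apply: cone_catl. Qed.

Lemma cone_mkseq_eq z z' : (forall n, cone (mkseq z n) z') -> z = z'.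
Proof.
move=> zz'; apply/funext => n; have /cone_word_mkseq := zz' n.+1.
rewrite size_mkseq => /(congr1 (fun s => nth true s n)).
by rewrite !nth_mkseq.
Qed.

Lemma cone_split w : cone w `<=` cone (rcons w true) `|` cone (rcons w false).
Proof.
move=> _ [eta _ <-]; have : cone (rcons w (eta 0%N)) (prepend w eta).
  exists (eta \o addn 1) => //; rewrite -cats1 prepend_cat; congr prepend.
  exact/esym/(prepend_mkseq 1).
by case: (eta 0%N) => ?; [left|right].
Qed.

(** Compactness of the Cantor set as an induction principle: if [Q] failed at
    the empty word, it would fail along an infinite branch of the binary tree,
    hence at every prefix of some point. *)
Lemma bisection (Q : seq bool -> Prop) :
  (forall w, Q (rcons w true) -> Q (rcons w false) -> Q w) ->
  (forall z, exists n, Q (mkseq z n)) -> Q [::].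
Proof.
move=> Qbis Qpt; apply: contrapT => nQ.
pose next w := rcons w (~~ `[< ~ Q (rcons w false) >]).
have nextP w : ~ Q w -> ~ Q (next w).
  move=> nQw; rewrite /next; case: asboolP => //= /contrapT Qf Qt.
  exact/nQw/Qbis.
pose u n := iter n next [::].
have nQu n : ~ Q (u n) by elim: n => [|n ihn] //=; apply: nextP.
pose z n := last true (u n.+1).
have uE n : u n = mkseq z n.
  elim: n => [|n ihn] //; rewrite mkseqS -ihn /z /= last_rcons //.
by have [n] := Qpt z; rewrite -uE; apply: nQu.
Qed.

End Words.

(** * Prefix replacement *)
Section Carries.
Implicit Types (f g : homeoC) (a b c r s w : seq bool) (z eta : cantor_space).

Definition carries f w b : Prop := forall eta, f (prepend w eta) = prepend b eta.

Lemma carries_cat f w b c : carries f w b -> carries f (w ++ c) (b ++ c).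
Proof. by move=> fwb eta; rewrite !prepend_cat fwb. Qed.

Lemma carries_one w : carries 1 w w.
Proof. by []. Qed.

Lemma carries_mul f g w b c : carries g w b -> carries f b c -> carries (f * g) w c.
Proof. by move=> gwb fbc eta; rewrite -fbc -gwb. Qed.

Lemma carries_inv f w b : carries f w b -> carries f^-1 b w.
Proof. by move=> fwb eta; rewrite -fwb; apply: homeo_funK. Qed.

Lemma carries_inj f w b c : carries f w b -> carries f w c -> b = c.
Proof. by move=> fb fc; apply: prepend_word_inj; apply/funext => e; rewrite -fb -fc. Qed.

Lemma carries_cone f w b z : carries f w b -> cone w z -> cone b (f z).
Proof. by move=> fwb [eta _ <-]; rewrite fwb; exists eta. Qed.

Definition distorts_by K f := forall w, (K <= size w)%N ->
  exists2 b, carries f w b & (size b <= size w + K)%N && (size w <= size b + K)%N.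

(** A word that is long enough extends one of the words of the table of [f], so
    [f] replaces its prefix, changing its length by a bounded amount. *)
Lemma thompsonV_bounded_distortion f : thompsonV f -> exists K, distorts_by K f.
Proof.
move=> [m [a [b [[_ aT] _ fab]]]].
exists (\max_(j < m) (size (a j) + size (b j)))%N => w wK.
have : [set: cantor_space] (prepend w (fun=> true)) by [].
rewrite -aT => -[j _ [y _ e]].
have jK : (size (a j) + size (b j) <= \max_(j < m) (size (a j) + size (b j)))%N.
  exact: (leq_bigmax (F := fun j => (size (a j) + size (b j))%N) j).
have [|c wE] := prepend_prefix (esym e); first lia.
by exists (b j ++ c); [rewrite wE; apply: carries_cat|rewrite wE !size_cat; lia].
Qed.

Lemma thompsonV_carries f z k : thompsonV f ->
  exists n b, carries f (mkseq z n) b /\ (k <= size b)%N.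
Proof.
move=> /thompsonV_bounded_distortion[K fK].
have [|b fb] := fK (mkseq z (K + k)); first by rewrite size_mkseq; lia.
by rewrite size_mkseq => ?; exists (K + k)%N, b; split => //; lia.
Qed.

Lemma thompsonV_continuity f w z : thompsonV f -> cone w (f z) ->
  exists n, forall z', cone (mkseq z n) z' -> cone w (f z').
Proof.
move=> /(@thompsonV_carries f z (size w))[n [b [fb wb]]] wfz; exists n => z' zz'.
have [//|c bE] := cone_prefix wfz (carries_cone fb (cone_mkseq z n)).
by apply: (@cone_catl _ c); rewrite -bE; apply: carries_cone zz'.
Qed.

End Carries.

(** * Two sources of free semigroups *)
Section FreeSemigroups.
Implicit Types (f g h q : homeoC) (r s : seq bool) (z eta : cantor_space).

(** Ping-pong: the image of [U] under a word reveals the first letter of the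
    word.  No nonempty word acts trivially, because the image of [U] under
    its first letter misses the image under the other one. *)
Lemma pingpong_free f g (U : set cantor_space) z0 :
  U z0 -> (forall z, U z -> U (f z)) -> (forall z, U z -> U (g z)) ->
  (forall z z', U z -> U z' -> f z <> g z') ->
  generates_free_semigroup f g.
Proof.
move=> Uz0 Uf Ug fg u v _ _.
pose ev (w : seq bool) : homeoC := \prod_(c <- w) (if c then f else g).
rewrite -[LHS]/(ev u) -[RHS]/(ev v).
have evS c w z : ev (c :: w) z = (if c then f else g) (ev w z).
  by rewrite /ev big_cons.
have Uev w z : U z -> U (ev w z).
  by elim: w z => [|[] w ihw] z Uz; rewrite ?evS ?/ev ?big_nil //; [apply/Uf/ihw|apply/Ug/ihw].
have no_one c w : ev [::] <> ev (c :: w).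
  rewrite {1}/ev big_nil => e.
  have E z : z = ev (c :: w) z by rewrite -e.
  have := E (if c then g z0 else f z0); rewrite evS; case: c {e E} => e.
    by apply: (fg (ev w (g z0)) z0) => //; apply: Uev; apply: Ug.
  by apply: (fg z0 (ev w (f z0))) => //; apply: Uev; apply: Uf.
elim: u v => [|c u ihu] [|d v] // e; first by case: (no_one d v).
  by case: (no_one c u).
have E z : ev (c :: u) z = ev (d :: v) z by rewrite e.
have := E z0; rewrite !evS; case: (c =P d) => [cd _|].
  rewrite (ihu v) ?cd //; apply: (mulgI (if c then f else g)).
  by move: e; rewrite /ev !big_cons cd.
case: c d {e E} => -[] // _ e; first by case: (fg _ _ (Uev u _ Uz0) (Uev v _ Uz0)).
by case: (fg _ _ (Uev v _ Uz0) (Uev u _ Uz0)).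
Qed.

(** The infinite word [s s s ...]. *)
Definition periodic (s : seq bool) : cantor_space := fun n => nth true s (n %% size s).

Lemma prepend_periodic s : s != [::] -> prepend s (periodic s) = periodic s.
Proof.
move=> s0; apply/funext => n; rewrite /prepend /periodic.
have [ns|sn] := ltnP n (size s).
  by rewrite [(n %% _)%N]modn_small //; apply: set_nth_default.
by rewrite nth_default // -{2}(subnK sn) modnDr.
Qed.

Fixpoint power s n : seq bool := if n is n'.+1 then s ++ power s n' else [::].

Lemma powerSr s n : power s n.+1 = power s n ++ s.
Proof. by elim: n => [|n ihn]; rewrite /= ?cats0 // {1}[LHS]/= -catA -ihn. Qed.

Lemma size_power s n : size (power s n) = (n * size s)%N.
Proof. by elim: n => //= n ihn; rewrite size_cat ihn. Qed.

Lemma prepend_power_periodic s n :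
  s != [::] -> prepend (power s n) (periodic s) = periodic s.
Proof.
move=> s0; elim: n => [|n ihn]; last by rewrite /= prepend_cat ihn prepend_periodic.
by apply/funext => n; rewrite /prepend subn0 nth_nil.
Qed.

(** The fixed point of a map that carries [r] to [r ++ s]. *)
Definition attractor r s : cantor_space := prepend r (periodic s).

Lemma cone_attractor r s n : s != [::] -> cone (r ++ power s n) (attractor r s).
Proof.
by move=> s0; exists (periodic s); rewrite // prepend_cat prepend_power_periodic.
Qed.

Lemma power_large s n : s != [::] -> (n <= size (power s n))%N.
Proof. by rewrite size_power; case: s => //= x s _; nia. Qed.

Lemma carries_iter q r s n : carries q r (r ++ s) -> carries (q ^+ n) r (r ++ power s n).
Proof.
move=> qr; elim: n => [|n ihn]; first by rewrite cats0.
by rewrite expgS /= catA; apply: carries_mul ihn _; apply: carries_cat.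
Qed.

(** If [h] sends the attractor to another point of the contracted cone, then the
    cone is mapped close to the attractor by a large power of [q], and close to
    its image under [h] by [h] after a large power of [q]. *)
Lemma pingpong_returning q h r s : thompsonV h ->
  s != [::] -> carries q r (r ++ s) ->
  cone r (h (attractor r s)) -> h (attractor r s) <> attractor r s ->
  exists m k, generates_free_semigroup (q ^+ k) (h * q ^+ m).
Proof.
move=> Vh s0 qr rhx hx.
have [k nk] : exists k, ~ cone (r ++ power s k) (h (attractor r s)).
  apply: contrapT => nex; apply: hx; symmetry; apply: cone_mkseq_eq => n.
  have kn : cone (r ++ power s n) (h (attractor r s)).
    by apply: contrapT => nk; apply: nex; exists n.
  apply: (@cone_mkseq_le _ n (size (r ++ power s n))).
    by rewrite size_cat; have := power_large n s0; lia.
  rewrite (_ : mkseq _ _ = r ++ power s n) //; apply/esym/cone_word_mkseq.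
  exact: cone_attractor.
have [n [b [hb bk]]] := thompsonV_carries (attractor r s) (size (r ++ power s k)) Vh.
have mb z : cone (r ++ power s n) z -> cone b (h z).
  move=> mz; apply: (carries_cone hb).
  apply: (@cone_mkseq_le _ n (size (r ++ power s n))).
    by rewrite size_cat; have := power_large n s0; lia.
  by rewrite -(cone_word_mkseq (cone_attractor r n s0)).
have bhx : cone b (h (attractor r s)) by apply: mb; apply: cone_attractor.
have br z : cone b z -> cone r z.
  have [|c ->] := cone_prefix rhx bhx; last exact: cone_catl.
  by move: bk; rewrite size_cat; lia.
have bnk z : cone b z -> ~ cone (r ++ power s k) z.
  move=> bz kz; have [c bE] := cone_prefix kz bz bk.
  by apply: nk; apply: (@cone_catl _ c); rewrite -bE.
have qm z j : cone r z -> cone (r ++ power s j) ((q ^+ j) z).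
  by move=> rz; apply: carries_cone rz; apply: carries_iter.
exists n, k; apply: (@pingpong_free _ _ (cone r) (attractor r s)).
- by exists (periodic s).
- by move=> z /(qm _ k) /cone_catl.
- by move=> z /(qm _ n) /mb /br.
- by move=> z z' /(qm _ k) kz /(qm _ n) /mb /bnk bz e; apply: bz; rewrite -[X in cone _ X]e.
Qed.

(** A lamplighter argument of Milnor.  As [f] is trivial on the image of the
    cone of [r] under [q], a word in [q] and [q * f] acts on that image as a
    power of [q], which determines its length.  If two words of the same length
    agree and have different last letters, then evaluating them at a point of
    the cone of [r] shows that [f] fixes this point. *)
Lemma lamplighter_free q f r s eta :
  s != [::] -> carries q r (r ++ s) -> carries f (r ++ s) (r ++ s) ->
  f (prepend r eta) <> prepend r eta ->
  generates_free_semigroup q (q * f).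
Proof.
move=> s0 qr frs f_eta u v _ _.
pose ev (w : seq bool) : homeoC := \prod_(c <- w) (if c then q else q * f).
rewrite -[LHS]/(ev u) -[RHS]/(ev v).
have evS w c z : ev (rcons w c) z = ev w ((if c then q else q * f) z).
  by rewrite /ev -cats1 big_cat /= big_seq1.
have evE w : carries (ev w) (r ++ s) (r ++ s ++ power s (size w)).
  elim/last_ind: w => [|w c ihw].
    by rewrite /ev big_nil /= cats0; apply: carries_one.
  move=> z; rewrite evS size_rcons.
  have -> : (if c then q else q * f) (prepend (r ++ s) z) = prepend (r ++ s) (prepend s z).
    have qE : q (prepend (r ++ s) z) = prepend (r ++ s) (prepend s z).
      by rewrite (carries_cat s qr) prepend_cat.
    by case: c => //; rewrite -qE -[in RHS](frs z).
  by rewrite ihw powerSr !prepend_cat.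
have size_eq w w' : ev w = ev w' -> size w = size w'.
  move=> e; have ww' := evE w; rewrite e in ww'.
  have /(congr1 size) := carries_inj ww' (evE w'); rewrite !size_cat !size_power.
  by move: s0; case: (s) => //= x t _; nia.
elim/last_ind: u v => [|u c ihu] v e.
  by have /= := size_eq _ _ e; case: v e.
elim/last_ind: v e => [|v d _] e; first by have := size_eq _ _ e; rewrite size_rcons.
have uv : size u = size v by have := size_eq _ _ e; rewrite !size_rcons => -[].
case: (c =P d) => [cd|].
  rewrite (ihu v) ?cd //; apply: (mulIg (if c then q else q * f)).
  by move: e; rewrite /ev -!cats1 !big_cat /= !big_seq1 cd.
suff W w w' : size w = size w' -> ev (rcons w true) <> ev (rcons w' false).
  by case: c d e => -[] // /[dup] e /esym e' _; [case: (W u v)|case: (W v u)].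
move=> ww' {e}e; have E z : ev (rcons w true) z = ev (rcons w' false) z by rewrite e.
apply: f_eta; have := E (prepend r eta); rewrite !evS qr prepend_cat -prepend_cat evE ww' -evE.
rewrite prepend_cat -prepend_cat -qr => /(can_inj (homeo_funK _)).
by move/(can_inj (homeo_funK _)).
Qed.

End FreeSemigroups.

(** * Contractions from long stacks *)

Lemma finite_words n : finite_set [set w : seq bool | (size w <= n)%N].
Proof.
apply: (@sub_finite_set _ _
  (range (fun p : n.-tuple bool * 'I_n.+1 => take p.2 p.1))).
  move=> w /= wn; have sw : size (w ++ nseq (n - size w) true) == n.
    by rewrite size_cat size_nseq subnKC.
  by exists (Tuple sw, Ordinal (wn : size w < n.+1)%N); rewrite //= take_size_cat.
exact/finite_image/finite_finset.
Qed.

Lemma uniform_distortion (A : set homeoC) : finite_set A -> A `<=` thompsonV ->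
  exists K, forall f, A f -> distorts_by K f.
Proof.
move=> /finite_seqP[s ->]; elim: s => [|f s ihs] sV; first by exists 0%N.
have [|K sK] := ihs; first by move=> g gs; apply: sV; rewrite /= inE orbC gs.
have [|k fk] := @thompsonV_bounded_distortion f; first by apply: sV; rewrite /= inE eqxx.
exists (maxn K k) => g; rewrite /= inE => /predU1P[->|/sK gK] w wK.
  by have [|b fb bk] := fk w; [lia|exists b => //; lia].
by have [|b gb bk] := gK w; [lia|exists b => //; lia].
Qed.

Section Generation.
Variable gT : groupType.
Implicit Types (G S : set gT).

Definition letters S : set gT := S `|` [set s^-1 | s in S].

Lemma lettersV S s : letters S s -> letters S s^-1.
Proof. by move=> [Ss|[t St <-]]; [right; exists s|left; rewrite invgK]. Qed.

Lemma finite_letters S : finite_set S -> finite_set (letters S).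
Proof. by move=> fS; rewrite finite_setU; split=> //; apply: finite_image. Qed.

Lemma letters_sub S G : subgroup G -> S `<=` G -> letters S `<=` G.
Proof. by move=> [_ _ GV] SG s [/SG//|[t /SG Gt <-]]; apply: GV. Qed.

Lemma generated_ind S (Q : gT -> Prop) :
  Q 1 -> (forall s g, letters S s -> Q g -> Q (s * g)) ->
  forall g, smallest (@subgroup gT) S g -> Q g.
Proof.
move=> Q1 QM g; pose A : set gT := [set g | forall h, Q h -> Q (g * h) /\ Q (g^-1 * h)].
suff /[apply] : smallest (@subgroup gT) S `<=` A.
  by move=> /(_ 1 Q1)[]; rewrite mulg1.
apply: smallest_sub; first split.
- by move=> h; rewrite invg1 mul1g.
- move=> x y Ax Ay h Qh; rewrite invgM -!mulgA.
  by split; [apply: (Ax _ (Ay _ Qh).1).1|apply: (Ay _ (Ax _ Qh).2).2].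
- by move=> x Ax h /Ax[]; rewrite invgK.
- by move=> s Ss h Qh; split; apply: QM => //; [left|right; exists s].
Qed.

End Generation.

Section Stack.
Variables (G S : set homeoC) (K : nat).
Hypothesis subG : subgroup G.
Hypothesis genG : G = smallest (@subgroup homeoC) S.
Hypothesis distK : forall s, letters S s -> distorts_by K s.
Implicit Types (g p q : homeoC) (b r s u w : seq bool) (y z : cantor_space).

Let G1 : G 1. Proof. by case: subG. Qed.
Let GM f g : G f -> G g -> G (f * g). Proof. by case: subG => _ + _; apply. Qed.

Let lettersG : letters S `<=` G.
Proof. by apply: letters_sub => //; rewrite genG; apply: sub_gen_smallest. Qed.

Definition contracted y := exists p q r s,
  [/\ G p /\ cone r (p y), G q, size r = K, s != [::] & carries q r (r ++ s)].

Definition step u w := [/\ (K <= size u)%N, (K <= size w)%N &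
  exists2 s, letters S s & carries s u w].

(** Paths along which at least [K] letters always remain on the stack, so that
    every letter acts by prefix replacement. *)
Inductive reach u : seq bool -> Prop :=
| reach_refl : (K <= size u)%N -> reach u u
| reach_step w w' : reach u w -> step w w' -> reach u w'.

Lemma reach_size u w : reach u w -> (K <= size u)%N /\ (K <= size w)%N.
Proof. by elim=> // ? ? _ [? _] [_ ? _]. Qed.

Lemma reach_carries u w : reach u w -> exists2 g, G g & carries g u w.
Proof.
elim=> [|w1 w2 _ [g Gg gw] [_ _ [s As sw]]]; first by exists 1.
by exists (s * g); [apply: GM => //; apply: lettersG|apply: carries_mul sw].
Qed.

Lemma reach_sym u w : reach u w -> reach w u.
Proof.
have reach_head w1 w2 w3 : step w1 w2 -> reach w2 w3 -> reach w1 w3.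
  move=> w12; elim=> [|v v' _ w1v vv']; last exact: reach_step w1v vv'.
  by move=> _; apply: (reach_step (reach_refl _) w12); case: w12.
elim=> [|w1 w2 _ w1u [w1K w2K [s As sw]]]; first exact: reach_refl.
apply: reach_head w1u; split=> //; exists s^-1; first exact: lettersV.
exact: carries_inv.
Qed.

(** What remains of a path from [u] to [w] that never reads below the first [K]
    letters of [u]: the other letters of [u] stay at the bottom of the stack. *)
Definition up u w := exists g b,
  [/\ G g, (K <= size b)%N, carries g (take K u) b & w = b ++ drop K u].

Lemma up_refl u : (K <= size u)%N -> up u u.
Proof.
by move=> uK; exists 1, (take K u); rewrite cat_take_drop; split=> //; rewrite size_takel.
Qed.

Lemma up_step u w w' : (K <= size u)%N -> up u w -> step w w' ->
  (size u <= size w')%N -> up u w'.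
Proof.
move=> uK [g [b [Gg bK gb ->]]] [_ _ [s As sw]] uw'.
have [c sc _] := distK As bK.
have w'E := carries_inj sw (carries_cat (drop K u) sc).
exists (s * g), c; split=> //; first by apply: GM => //; apply: lettersG.
  by move: uw'; rewrite w'E size_cat size_drop; lia.
exact: carries_mul sc.
Qed.

(** Without contractions, the successive levels of the stack below which the path
    no longer looks carry pairwise different words of length [K], and each such
    level is at most [K] above the previous one. *)
Lemma rise_bound y u w : ~ contracted y -> cone u y -> reach u w ->
  (size w <= size u + K * #|{: K.-tuple bool}|)%N.
Proof.
move=> ncy uy.
(* [T l w'] collects the words of length [K] that were on top of the stack at
   some height below [l] such that [w'] was reached without looking below them. *)
pose T l w' := [pred t : K.-tuple bool | `[< exists v,
  [/\ reach u v, up v w', (size v < l)%N & take K v = t] >]].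
suff Tw w' l : reach u w' -> (size u <= l <= size w')%N -> (l <= size u + K * #|T l w'|)%N.
  move=> uw; have [/ltnW wu|uw'] := ltnP (size w) (size u).
    by rewrite (leq_trans wu) ?leq_addr.
  apply: leq_trans (Tw w (size w) uw _) _; first by rewrite uw' /=.
  by rewrite leq_add2l leq_mul2l max_card orbT.
move=> uw'; elim: uw' l => {w w'} [_|w w' uw ihw ww'] l ul.
  by rewrite (_ : l = size u) ?leq_addr //; lia.
have [_ wK] := reach_size uw.
have Tsub k : (k <= l)%N -> (k <= size w')%N -> {subset T k w <= T l w'}.
  move=> kl kw' t /asboolP[v [uv vw vk tE]]; apply/asboolP; exists v; split=> //; last lia.
  by apply: up_step ww' _ => //; [case: (reach_size uv)|lia].
have [lw|wl] := leqP l (size w).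
  apply: (leq_trans (ihw l _)); first lia.
  rewrite leq_add2l leq_mul2l; apply/orP; right; apply/subset_leq_card/fintype.subsetP.
  by apply: Tsub => //; lia.
have tKw : size (take K w) == K by rewrite size_takel.
have Tw' : T l w' (Tuple tKw).
  apply/asboolP; exists w; split=> //; apply: up_step ww' _ => //; last lia.
  exact: up_refl.
have w'w : (size w' <= size w + K)%N.
  have [_ _ [s As sw]] := ww'; have [b sb bK] := distK As wK.
  by rewrite (carries_inj sw sb); lia.
have [wu|uw'] := ltnP (size w) (size u).
  have : (0 < #|T l w'|)%N by apply/card_gt0P; exists (Tuple tKw).
  by nia.
(* A top word recurring at a higher level is carried to an extension of itself,
   which is a contraction; so the top word of [w] is new. *)
have nTw : ~~ T (size w) w (Tuple tKw).
  apply/negP => /asboolP[v [uv [g [b [Gg bK gb wE]]] vw /= vwE]].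
  have [_ vK] := reach_size uv.
  have bE : b = take K w ++ drop K b by rewrite wE takel_cat // cat_take_drop.
  have [p Gp pv] := reach_carries uv.
  apply: ncy; exists p, g, (take K v), (drop K b); split=> //.
  - split=> //; apply: (@cone_catl _ (drop K v)); rewrite cat_take_drop.
    exact: carries_cone uy.
  - by rewrite size_takel.
  - apply: contraTneq vw => bs; have : size (drop K b) = 0%N by rewrite bs.
    by rewrite wE size_cat !size_drop => ?; lia.
  - by rewrite vwE -bE -vwE.
have := ihw (size w); rewrite uw' leqnn => /(_ isT) ih.
have : (#|T (size w) w|.+1 <= #|T l w'|)%N.
  have /= := cardU1 (Tuple tKw) (mem (T (size w) w)); rewrite nTw add1n => <-.
  apply/subset_leq_card/fintype.subsetP => t /predU1P[->//|]; apply: Tsub; lia.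
by nia.
Qed.

Lemma contracted_translate g y : G g -> contracted (g y) -> contracted y.
Proof.
move=> Gg [p [q [r [s [[Gp py] Gq rK s0 qr]]]]].
by exists (p * g), q, r, s; split=> //; split=> //; apply: GM.
Qed.

(** If [y] is not contracted, [rise_bound] applies to paths in both directions,
    and with enough letters of [y] on the initial stack no path ever runs out of
    letters; so only boundedly long prefixes arise. *)
Lemma contracted_or_rigid y : contracted y \/
  exists2 w, cone w y &
    finite_set [set (fun eta => g (prepend w eta)) | g in G].
Proof.
have [cy|ncy] := pselect (contracted y); [by left|right].
(* A fall costs at most [B] letters, and [K + K] remaining letters leave at
   least [K] of them after one more generator. *)
pose B := (K * #|{: K.-tuple bool}|)%N; pose w0 := mkseq y (K + K + B).
have w0y : cone w0 y by apply: cone_mkseq.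
exists w0 => //.
have reachG g : G g -> exists2 w, reach w0 w & carries g w0 w.
  rewrite genG; move: g; apply: generated_ind => [|s g As [w w0w gw]].
    by exists w0 => //; apply: reach_refl; rewrite size_mkseq; lia.
  have [h Gh hw] := reach_carries w0w.
  have wB : (size w0 <= size w + B)%N.
    apply: (@rise_bound (h y)) (reach_sym w0w).
      by move=> /(contracted_translate Gh)/ncy.
    exact: carries_cone w0y.
  rewrite size_mkseq in wB; have [|b sb bK] := distK As (w := w); first lia.
  exists b; last exact: carries_mul sb.
  by apply: reach_step w0w _; split; [lia|lia|exists s].
apply: sub_finite_set (finite_image prepend (finite_words (size w0 + B))).
move=> _ [g /reachG[w w0w gw] <-]; exists w; first exact: rise_bound ncy w0y w0w.
by apply/funext => eta; rewrite gw.
Qed.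

End Stack.

(** * Subgroups of finite index *)
Section FiniteIndex.
Variable gT : groupType.
Implicit Types (G N : set gT).

Definition finite_index G N := [/\ subgroup N, N `<=` G & finite_set (left_cosets G N)].

(** The map [phi] determines left cosets of [N], so that there are at most as many
    of them as values of [phi] on [G]. *)
Lemma finite_index_separated X (phi : gT -> X) G N :
  subgroup N -> N `<=` G -> finite_set [set phi g | g in G] ->
  (forall g h, G g -> G h -> phi g = phi h -> N (g^-1 * h)) -> finite_index G N.
Proof.
move=> subN NG finG sepN; split=> //.
pose psi v : set gT := [set x | exists g h, [/\ G g, phi g = v, N h & x = g * h]].
apply: sub_finite_set (finite_image psi finG) => _ [g Gg <-].
exists (phi g); first by exists g.
case: subN => _ NM _; apply/seteqP; split=> [_ [k [h [Gk kg Nh ->]]]|_ [h Nh <-]].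
  exists (g^-1 * k * h); last by rewrite -!mulgA mulVKg.
  by apply: NM => //; apply: sepN.
by exists g, h.
Qed.

Lemma coset_eqP N g h : subgroup N ->
  [set g * n | n in N] = [set h * n | n in N] -> N (g^-1 * h).
Proof.
move=> [N1 _ _] gh; have : [set h * n | n in N] h by exists 1; rewrite ?mulg1.
by rewrite -gh => -[n Nn <-]; rewrite mulKg.
Qed.

Lemma finite_indexI G N M : finite_index G N -> finite_index G M ->
  finite_index G (N `&` M).
Proof.
move=> [subN NG finN] [subM MG finM].
apply: (@finite_index_separated _
  (fun g => ([set g * n | n in N], [set g * n | n in M]))).
- case: subN subM => N1 NM NV [M1 MM MV]; split=> //.
  + by move=> x y [Nx Mx] [Ny My]; split; [apply: NM|apply: MM].
  + by move=> x [Nx Mx]; split; [apply: NV|apply: MV].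
- by move=> x [/NG].
- by apply: finite_image11; [exact: finN|exact: finM].
- by move=> g h _ _ [/(coset_eqP subN) ? /(coset_eqP subM)].
Qed.

Lemma finite_index_conj G N p : subgroup G -> G p -> finite_index G N ->
  finite_index G [set g | N (p * g * p^-1)].
Proof.
move=> [_ GM GV] Gp [subN NG finN]; have [N1 NM NV] := subN.
apply: (@finite_index_separated _ (fun g => [set p * g * p^-1 * n | n in N])).
- split => /=; first by rewrite mulg1 mulgV.
  + move=> x y Nx Ny; rewrite (_ : _ * _ = p * x * p^-1 * (p * y * p^-1)); first exact: NM.
    by rewrite -!mulgA mulKg.
  + by move=> x /NV; rewrite !invgM invgK mulgA.
- move=> x /= /NG Gx; rewrite (_ : x = p^-1 * (p * x * p^-1) * p).
    by apply: (GM) => //; apply: (GM) => //; apply: GV.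
  by rewrite -!mulgA mulVg mulg1 mulKg.
- apply: sub_finite_set finN => _ [g Gg <-]; exists (p * g * p^-1) => //.
  by apply: (GM); [apply: (GM)|apply: GV].
- move=> g h _ _ /(coset_eqP subN) /=.
  by rewrite !invgM invgK -!mulgA mulKg.
Qed.

End FiniteIndex.

Lemma finite_index_stabilizer (G : set homeoC) x : subgroup G ->
  finite_set [set g x | g in G] -> finite_index G [set g | G g /\ g x = x].
Proof.
move=> [G1 GM GV] finx.
apply: (@finite_index_separated _ _ (fun g : homeoC => g x)) => //.
- split=> [//|g h [Gg gx] [Gh hx]|g [Gg gx]]; split.
  + exact: GM.
  + exact: etrans (congr1 g hx) gx.
  + exact: GV.
  + exact: etrans (congr1 (homeo_inv g) (esym gx)) (homeo_funK g x).
- by move=> g [].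
- move=> g h Gg Gh gh; split; first by apply: GM => //; apply: GV.
  by rewrite -[RHS](homeo_funK g) gh.
Qed.

Lemma finite_index_rigid (G : set homeoC) w : subgroup G ->
  finite_set [set (fun eta => g (prepend w eta)) | g in G] ->
  finite_index G [set g | G g /\ carries g w w].
Proof.
move=> [G1 GM GV] finw.
apply: (@finite_index_separated _ _ (fun (g : homeoC) eta => g (prepend w eta))) => //.
- split=> [//|g h [Gg gx] [Gh hx]|g [Gg gx]]; split.
  + exact: GM.
  + exact: carries_mul gx.
  + exact: GV.
  + exact: carries_inv.
- by move=> g [].
- move=> g h Gg Gh gh; split; first by apply: GM => //; apply: GV.
  move=> eta; rewrite -[RHS](homeo_funK g).
  by have := congr1 (fun F : cantor_space -> cantor_space => F eta) gh => /= ->.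
Qed.

(** * Germs *)

(** The constants [m] and [i] describe the germ of [f] at its fixed point [x]:
    near [x], lengths of prefixes of [x] are shifted by [i - m]. *)
Lemma fixed_germ_shift f x : thompsonV f -> f x = x ->
  exists m i, forall n, carries f (mkseq x (m + n)) (mkseq x (i + n)).
Proof.
move=> Vf fx; have [m [b [fb _]]] := thompsonV_carries x 0 Vf.
have bE : b = mkseq x (size b).
  by apply: cone_word_mkseq; rewrite -[x]fx; apply: carries_cone fb (cone_mkseq _ _).
exists m, (size b) => n; rewrite mkseq_cat.
have fmn := carries_cat (mkseq (x \o addn m) n) fb.
suff -> : mkseq x (size b + n) = b ++ mkseq (x \o addn m) n by [].
have : cone (b ++ mkseq (x \o addn m) n) x.
  by rewrite -{2}fx; apply: carries_cone fmn _; rewrite -mkseq_cat; apply: cone_mkseq.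
by move/cone_word_mkseq => ->; rewrite size_cat !size_mkseq.
Qed.

Lemma germs_commute f g x : thompsonV f -> thompsonV g -> f x = x -> g x = x ->
  exists n b, carries (f * g) (mkseq x n) b /\ carries (g * f) (mkseq x n) b.
Proof.
move=> Vf Vg /(fixed_germ_shift Vf)[m [i fm]] /(fixed_germ_shift Vg)[k [j gk]].
exists (m + k)%N, (mkseq x (i + j)); split.
  rewrite addnC; apply: carries_mul (gk m) _; rewrite addnC; exact: fm.
by rewrite [(i + j)%N]addnC; apply: carries_mul (fm k) _; rewrite addnC; exact: gk.
Qed.

(** * Groups without free semigroups *)
Section NoFreeSemigroup.
Variable G : set homeoC.
Hypothesis subG : subgroup G.
Hypothesis GV : G `<=` thompsonV.
Hypothesis nofree : ~ contains_free_semigroup G.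
Implicit Types (f g h p q : homeoC) (b r s u w : seq bool) (x y z : cantor_space).

Let G1 : G 1. Proof. by case: subG. Qed.
Let GM f g : G f -> G g -> G (f * g). Proof. by case: subG => _ + _; apply. Qed.
Let Ginv g : G g -> G g^-1. Proof. by case: subG => _ _; apply. Qed.
Let GX g n : G g -> G (g ^+ n).
Proof. by move=> Gg; elim: n => [|n ihn] //; rewrite expgS; apply: GM. Qed.

Lemma attractor_isolated q r s h : G q -> s != [::] -> carries q r (r ++ s) ->
  G h -> cone r (h (attractor r s)) -> h (attractor r s) = attractor r s.
Proof.
move=> Gq s0 qr Gh rhx; apply: contrapT => hx; apply: nofree.
have [m [k fr]] := pingpong_returning (GV Gh) s0 qr rhx hx.
by exists (q ^+ k), (h * q ^+ m); split=> //; [apply: GX|apply: GM => //; apply: GX].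
Qed.

(** The set where [f] is known to be trivial is enlarged from the image of a cone
    under [q] to that cone, one power of [q] at a time. *)
Lemma trivial_germ_spreads q r s f n : G q -> s != [::] -> carries q r (r ++ s) ->
  G f -> carries f (mkseq (attractor r s) n) (mkseq (attractor r s) n) -> carries f r r.
Proof.
move=> Gq s0 qr Gf fn.
have {fn} : carries f (r ++ power s n) (r ++ power s n).
  rewrite (cone_word_mkseq (cone_attractor r n s0)).
  rewrite -(@subnKC n (size (r ++ power s n))); last first.
    by rewrite size_cat; have := power_large n s0; lia.
  by rewrite mkseq_cat; apply: carries_cat.
elim: n => [|n ihn] fn; first by move: fn; rewrite /= cats0.
apply: ihn => eta; apply: contrapT => f_eta; apply: nofree.
exists q, (q * f); split=> //; first exact: GM.
apply: (lamplighter_free s0 _ _ f_eta); last by rewrite -catA -powerSr.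
by rewrite -catA -powerSr /= catA; apply: carries_cat.
Qed.

Definition abelian_on (O : set cantor_space) := exists2 N, finite_index G N &
  forall f g, N f -> N g -> forall z, O z -> f (g z) = g (f z).

Lemma abelian_on_sub (O U : set cantor_space) : U `<=` O -> abelian_on O -> abelian_on U.
Proof. by move=> UO [N fN cN]; exists N => // f g Nf Ng z /UO; apply: cN. Qed.

Lemma abelian_onU O U : abelian_on O -> abelian_on U -> abelian_on (O `|` U).
Proof.
move=> [N fN cN] [M fM cM]; exists (N `&` M); first exact: finite_indexI.
by move=> f g [Nf Mf] [Ng Mg] z []; [apply: cN|apply: cM].
Qed.

Lemma abelian_on_preimage p O : G p -> abelian_on O -> abelian_on (p @^-1` O).
Proof.
move=> Gp [N fN cN]; exists [set g | N (p * g * p^-1)]; first exact: finite_index_conj.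
move=> f g /= Nf Ng z /(cN _ _ Nf Ng).
have cE (k : homeoC) y : (p * k * p^-1) (p y) = p (k y).
  by rewrite -[in RHS](homeo_funK p y).
by rewrite !cE => /(can_inj (homeo_funK p)).
Qed.

Lemma abelian_on_rigid w : finite_set [set (fun eta => g (prepend w eta)) | g in G] ->
  abelian_on (cone w).
Proof.
move=> /(finite_index_rigid subG) fN; eexists; first exact: fN.
by move=> f g [_ fw] [_ gw] _ [eta _ <-]; rewrite fw gw fw.
Qed.

(** The commutator of two elements of the stabilizer of the attractor has a
    trivial germ there, and hence is trivial on the contracted cone. *)
Lemma abelian_on_attractor q r s : G q -> s != [::] -> carries q r (r ++ s) ->
  finite_set [set g (attractor r s) | g in G] -> abelian_on (cone r).
Proof.
move=> Gq s0 qr finx; exists [set g | G g /\ g (attractor r s) = attractor r s].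
  exact: finite_index_stabilizer.
move=> f g [Gf fx] [Gg gx].
have [n [b [fgb gfb]]] := germs_commute (GV Gf) (GV Gg) fx gx.
have : carries ((g * f)^-1 * (f * g)) r r.
  apply: (@trivial_germ_spreads q r s _ n) => //.
    by apply: GM; [apply/Ginv/GM|apply: GM].
  by apply: carries_mul fgb _; apply: carries_inv.
move=> com _ [eta _ <-]; have := congr1 (g * f) (com eta).
exact: etrans (esym (homeo_invK (g * f) _)).
Qed.

(** The point [z] lies in the closure of the orbit of [y]. *)
Definition adherent y z := forall n, exists2 g, G g & cone (mkseq z n) (g y).

Lemma adherent_visits y z g w : adherent y z -> G g -> cone w (g z) ->
  exists2 h, G h & cone w (h y).
Proof.
move=> yz Gg wgz; have [n nw] := thompsonV_continuity (GV Gg) wgz.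
have [h Gh hy] := yz n; exists (g * h); [exact: GM|exact: nw].
Qed.

Lemma adherent_trans y x z : adherent y x -> adherent x z -> adherent y z.
Proof. by move=> yx xz n; have [g Gg] := xz n; apply: adherent_visits. Qed.

(** Every point has a neighbourhood containing at most one point of the orbit:
    points outside its closure trivially, and the others because some element of
    [G] maps them into the cone of [r], where the attractor is isolated in its
    orbit.  Compactness concludes. *)
Lemma finite_orbit_attractor q r s : G q -> s != [::] -> carries q r (r ++ s) ->
  (forall z, adherent (attractor r s) z -> exists2 g, G g & cone r (g z)) ->
  finite_set [set g (attractor r s) | g in G].
Proof.
move=> Gq s0 qr visits; set x := attractor r s.
suff : finite_set [set z | cone [::] z /\ exists2 g, G g & z = g x].
  apply: sub_finite_set => _ [g Gg <-]; split; last by exists g.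
  exact: (cone_mkseq _ 0).
apply: (@bisection (fun w => finite_set [set z | cone w z /\ exists2 g, G g & z = g x])).
  move=> w ft ff; apply: sub_finite_set (_ : finite_set (_ `|` _)) => [z [wz xz]|]; last first.
    by rewrite finite_setU; split; [exact: ft|exact: ff].
  by case: (cone_split wz) => ?; [left|right].
move=> z; have [xz|nxz] := pselect (adherent x z); last first.
  have [n nxzn] : exists n, ~ exists2 g, G g & cone (mkseq z n) (g x).
    by apply: contrapT => nex; apply: nxz => n; apply: contrapT => ?; apply: nex; exists n.
  exists n; apply: sub_finite_set (finite_set0 _) => z1 [zn [g Gg gx]].
  by apply: nxzn; exists g => //; rewrite -gx.
have [g Gg rgz] := visits z xz.
have [n nr] := thompsonV_continuity (GV Gg) rgz.
exists n; apply: sub_finite_set (finite_set1 (homeo_inv g x)) => z1 [/nr rz [h Gh zE]].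
rewrite /= zE -[LHS](homeo_funK g); congr homeo_inv.
by apply: (attractor_isolated Gq s0 qr (GM Gg Gh)); rewrite /= -[h _]zE.
Qed.

Definition visited k y := [pred t : k.-tuple bool | `[< exists2 g, G g & cone t (g y) >]].

(** Induction on the number of cones of depth [K] visited by the orbit of [y].
    When it enters a contracted cone [r], either some point in the closure of the
    orbit of the attractor never visits [r], and the induction applies to this
    point, or the attractor has a finite orbit. *)
Lemma abelian_near S y : finite_set S -> G = smallest (@subgroup homeoC) S ->
  exists n, abelian_on (cone (mkseq y n)).
Proof.
move=> finS genG.
have [|K distK] := uniform_distortion (finite_letters finS).
  apply: subset_trans GV; apply: letters_sub => //; rewrite genG.
  exact: sub_gen_smallest.
suff [p Gp [w wpy abw]] : exists2 p, G p & exists2 w, cone w (p y) & abelian_on (cone w).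
  have [n nw] := thompsonV_continuity (GV Gp) wpy.
  by exists n; apply: abelian_on_sub (abelian_on_preimage Gp abw) => z /nw.
have [n] := ubnP #|visited K y|; elim: n y => // n ihn y yn.
have [[p [q [r [s [[Gp rpy] Gq rK s0 qr]]]]]|[w wy finw]] :=
    contracted_or_rigid subG genG distK y; last first.
  by exists 1 => //; exists w => //; apply: abelian_on_rigid.
set x := attractor r s; have yx : adherent y x.
  move=> k; exists (q ^+ k * p); first by apply: GM => //; apply: GX.
  apply: (@cone_mkseq_le _ k (size (r ++ power s k))).
    by rewrite size_cat; have := power_large k s0; lia.
  rewrite -(cone_word_mkseq (cone_attractor r k s0)).
  exact: carries_cone (carries_iter k qr) rpy.
have [[z xz nrz]|visits] :=
    pselect (exists2 z, adherent x z & ~ exists2 g, G g & cone r (g z)); last first.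
  exists p => //; exists r => //; apply: (abelian_on_attractor Gq s0 qr).
  apply: (finite_orbit_attractor Gq s0 qr) => z xz; apply: contrapT => nrz.
  by apply: visits; exists z.
have yz := adherent_trans yx xz.
have [|p' Gp' [w wpz abw]] := ihn z.
  rewrite -ltnS; apply: leq_trans yn; apply: proper_card; apply/properP; split.
    apply/fintype.subsetP => t /asboolP[g Gg tgz]; apply/asboolP.
    exact: adherent_visits yz Gg tgz.
  have rK' : size r == K by apply/eqP.
  exists (Tuple rK'); first by apply/asboolP; exists p.
  by apply/negP => /asboolP.
have [h Gh why] := adherent_visits yz Gp' wpz.
by exists h => //; exists w.
Qed.

End NoFreeSemigroup.

Theorem theoremC (G : set (homeo cantor_space)) :
  subgroup G -> G `<=` thompsonV -> finitely_generated G ->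
  virtually_abelian G \/ contains_free_semigroup G.
Proof.
move=> subG GV [S finS genG].
have [free|nofree] := pselect (contains_free_semigroup G); [by right|left].
have [N [subN NG finN] cN] : abelian_on G (cone [::]).
  apply: (@bisection (fun w => abelian_on G (cone w))) => [w abt abf|z].
    by apply: abelian_on_sub (abelian_onU abt abf); apply: cone_split.
  exact: abelian_near finS genG.
exists N; split=> // f g Nf Ng; apply: homeoP => z.
exact: cN (cone_mkseq z 0).
Qed.
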